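(* Let $\mathcal M$, $\mathcal M^{\uparrow}$ and $\mathcal M_{\downarrow}$ be the potential solution region, the outer approximation and the inner approximation defined in the context. Then $\mathcal M_{\downarrow}\subseteq\mathcal M\subseteq\mathcal M^{\uparrow}$.
   Context: Fix a positive integer $n$, real numbers $r,\sigma_1,\sigma_2,L>0$, and $\mathbf x_1^*=(-r,0,\dots,0)$, $\mathbf x_2^*=(r,0,\dots,0)\in\mathbb R^n$. $\|\cdot\|$ is the Euclidean norm. For $\mathbf x^*\in\mathbb R^n$ and $\sigma>0$, $\mathcal S(\mathbf x^*,\sigma)$ is the set of all differentiable functions $f:\mathbb R^n\to\mathbb R$ that are $\sigma$-strongly convex, i.e. $\langle\nabla f(\mathbf x)-\nabla f(\mathbf y),\mathbf x-\mathbf y\rangle\ge\sigma\|\mathbf x-\mathbf y\|^2$ for all $\mathbf x,\mathbf y$, and have their minimizer at $\mathbf x^*$. The potential solution region is $$\mathcal M=\{\mathbf x\in\mathbb R^n:\exists f_1\in\mathcal S(\mathbf x_1^*,\sigma_1),\ \exists f_2\in\mathcal S(\mathbf x_2^*,\sigma_2),\ \nabla f_1(\mathbf x)=-\nabla f_2(\mathbf x),\ \|\nabla f_1(\mathbf x)\|=\|\nabla f_2(\mathbf x)\|\le L\}.$$ $\angle(\mathbf u,\mathbf v)=\arccos\frac{\langle\mathbf u,\mathbf v\rangle}{\|\mathbf u\|\|\mathbf v\|}\in[0,\pi]$ for nonzero $\mathbf u,\mathbf v$. For $i\in\{1,2\}$: $\mathcal B_i=\{\mathbf x\in\mathbb R^n:\|\mathbf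 x-\mathbf x_i^*\|<L/\sigma_i\}$; $\tilde\phi_i(\mathbf x)=\arccos\big(\frac{\sigma_i}{L}\|\mathbf x-\mathbf x_i^*\|\big)$ for $\mathbf x\in\overline{\mathcal B}_i$; $\alpha_i(\mathbf x)=\angle(\mathbf x-\mathbf x_i^*,\mathbf x_2^*-\mathbf x_1^* )$ for $\mathbf x\ne\mathbf x_i^*$. For $\mathbf x\notin\{\mathbf x_1^*,\mathbf x_2^*\}$, $\psi(\mathbf x)=\pi-(\alpha_2(\mathbf x)-\alpha_1(\mathbf x))$. Let $\mathcal X=\{\mathbf x\in\mathbb R^n:\|\mathbf x-\mathbf x_i^*\|=L/\sigma_i\text{ for }i=1,2\}$ if $\|\mathbf x_2^*-\mathbf x_1^*\|=L\big(\frac1{\sigma_1}+\frac1{\sigma_2}\big)$, and $\mathcal X=\emptyset$ otherwise. Then $$\mathcal M^{\uparrow}=\{\mathbf x\in\mathbb R^n:\tilde\phi_1(\mathbf x)+\tilde\phi_2(\mathbf x)\ge\psi(\mathbf x)\},\qquad \mathcal M_{\downarrow}=\{\mathbf x\in\mathbb R^n:\tilde\phi_1(\mathbf x)+\tilde\phi_2(\mathbf x)>\psi(\mathbf x)\}\cup\mathcal X,$$ where in the inequalities $\mathbf x$ is implicitly required to lie in the common domain $(\overline{\mathcal B}_1\cap\overline{\mathcal B}_2)\setminus\{\mathbf x_1^*,\mathbf x_2^*\}$ of $\tilde\phi_1,\tilde\phi_2,\psi$. *)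

(* Defs.v *)
From HB Require Import structures.
From mathcomp Require Import all_boot all_order all_algebra.
From mathcomp Require Import all_classical all_reals all_analysis.
Import Order.TTheory GRing.Theory Num.Theory.
Import numFieldNormedType.Exports.

Set Implicit Arguments.
Unset Strict Implicit.
Unset Printing Implicit Defensive.

Local Open Scope classical_set_scope.
Local Open Scope ring_scope.

Section EuclideanSpace.
Context {R : realType} {n : nat}.
Implicit Types u v x : 'rV[R]_n.

Definition inner u v : R := \sum_(i < n) u 0 i * v 0 i.

(* The library norm `|u| on 'rV[R]_n is the sup norm; it induces the same
   topology (hence the same closures and differentiable functions). *)
Definition enorm u : R := Num.sqrt (inner u u).

(* Only meaningful for nonzero u and v. *)
Definition angle u v : R := acos (inner u v / (enorm u * enorm v)).

Definition gradient (f : 'rV[R]_n -> R) x : 'rV[R]_n :=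
  \row_(i < n) 'D_(delta_mx 0 i) f x.

Definition strongly_convex (sigma : R) (f : 'rV[R]_n -> R) : Prop :=
  forall x y,
    sigma * enorm (x - y) ^+ 2 <= inner (gradient f x - gradient f y) (x - y).

Definition is_minimizer (f : 'rV[R]_n -> R) xs : Prop :=
  forall y, f xs <= f y.

Definition S_class xs (sigma : R) : set ('rV[R]_n -> R) :=
  [set f | [/\ forall x, differentiable f x,
               strongly_convex sigma f
             & is_minimizer f xs]].

End EuclideanSpace.

Section SolutionRegion.
Context {R : realType}.
Variables (n : nat) (r sigma1 sigma2 L : R).
Implicit Type x : 'rV[R]_n.

Definition xstar1 : 'rV[R]_n := \row_(i < n) (if i == 0%N :> nat then - r else 0).
Definition xstar2 : 'rV[R]_n := \row_(i < n) (if i == 0%N :> nat then r else 0).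

Definition solution_region : set 'rV[R]_n :=
  [set x | exists f1 f2 : 'rV[R]_n -> R,
    [/\ S_class xstar1 sigma1 f1,
        S_class xstar2 sigma2 f2,
        gradient f1 x = - gradient f2 x,
        enorm (gradient f1 x) = enorm (gradient f2 x)
      & enorm (gradient f2 x) <= L]].

Definition eball (c : 'rV[R]_n) (rho : R) : set 'rV[R]_n :=
  [set x | enorm (x - c) < rho].

Definition B1 := eball xstar1 (L / sigma1).
Definition B2 := eball xstar2 (L / sigma2).

Definition phi1 x : R := acos (sigma1 / L * enorm (x - xstar1)).
Definition phi2 x : R := acos (sigma2 / L * enorm (x - xstar2)).

Definition alpha1 x : R := angle (x - xstar1) (xstar2 - xstar1).
Definition alpha2 x : R := angle (x - xstar2) (xstar2 - xstar1).

Definition psi x : R := pi - (alpha2 x - alpha1 x).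

(* Common domain of phi1, phi2 and psi, which are junk-valued outside it. *)
Definition domain : set 'rV[R]_n :=
  (closure B1 `&` closure B2) `\` [set xstar1; xstar2].

Definition tangency_set : set 'rV[R]_n :=
  [set x | enorm (xstar2 - xstar1) = L * (sigma1^-1 + sigma2^-1) /\
           (enorm (x - xstar1) = L / sigma1 /\
            enorm (x - xstar2) = L / sigma2)].

Definition outer_region : set 'rV[R]_n :=
  [set x | domain x /\ phi1 x + phi2 x >= psi x].

Definition inner_region : set 'rV[R]_n :=
  [set x | domain x /\ phi1 x + phi2 x > psi x] `|` tangency_set.

End SolutionRegion.

Arguments solution_region {R} n r sigma1 sigma2 L _.
Arguments outer_region {R} n r sigma1 sigma2 L _.
Arguments inner_region {R} n r sigma1 sigma2 L _.

(* Main.v *)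
Require Import Defs.
From HB Require Import structures.
From mathcomp Require Import all_boot all_order all_algebra.
From mathcomp Require Import all_classical all_reals all_analysis.
From mathcomp Require Import ring lra.
Import Order.TTheory GRing.Theory Num.Theory.
Import numFieldNormedType.Exports.

Local Open Scope classical_set_scope.
Local Open Scope ring_scope.

Set Implicit Arguments.
Unset Strict Implicit.
Unset Printing Implicit Defensive.

(** Write [u = x - x1*] and [v = x - x2*], so that [u - v = x2* - x1*]. Since
    the gradient of a strongly convex function vanishes at its minimizer, a
    vector [g] can only be the gradient at [x] of a member of the class with
    center [c] if [<g, x - c> >= sigma |x - c|^2] ([S_class_gradient_ge]).
    For [|g| <= L] this confines [g] to the cone around [x - c] of half-angle
    [acos (sigma / L * |x - c|)] ([gradient_cone]). Membership of [x] in the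
    solution region asks for one vector [g] in the cone of half-angle [phi1]
    around [u] such that [-g] is in the cone of half-angle [phi2] around [v].
    By the triangle inequality for angles ([angle_triangle]) this forces
    [phi1 + phi2 >= pi - angle u v]. The right-hand side is [psi x], because
    [alpha2] is an exterior angle of the triangle [x, x1*, x2*] in which
    [alpha1] and [angle u v] are the opposite interior angles
    ([exterior_angle]). That is the outer inclusion.

    Conversely, every [g] with [<g, x - c> > sigma |x - c|^2], as well as
    [g = sigma (x - c)], is realized by a quadratic function: [sigma / 2] times
    the squared distance to [c], plus a rank-one positive semidefinite form
    that accounts for [w = g - sigma (x - c)] ([S_class_gradientP]). It remains
    to find a common direction. When [phi1 + phi2 > pi - angle u v] the cones
    around [u] and [-v] overlap, and [direction_in_cones] produces a unit vector
    that lies in the interior of each cone, or on the axis of a cone that is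
    degenerate. At a point of tangency of the two balls, [g = sigma1 u] works
    directly because [u] and [v] are then opposite. *)

(** * The Euclidean inner product and norm *)

Section InnerProduct.
Context {R : realType} {n : nat}.
Implicit Types (u v w x : 'rV[R]_n) (a : R).

Lemma innerC u v : inner u v = inner v u.
Proof. by apply: eq_bigr => i _; rewrite mulrC. Qed.

Lemma innerDl u v w : inner (u + v) w = inner u w + inner v w.
Proof. by rewrite -big_split; apply: eq_bigr => i _; rewrite !mxE mulrDl. Qed.

Lemma innerZl a u v : inner (a *: u) v = a * inner u v.
Proof. by rewrite mulr_sumr; apply: eq_bigr => i _; rewrite !mxE mulrA. Qed.

Lemma innerNl u v : inner (- u) v = - inner u v.
Proof. by rewrite -scaleN1r innerZl mulN1r. Qed.

Lemma innerBl u v w : inner (u - v) w = inner u w - inner v w.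
Proof. by rewrite innerDl innerNl. Qed.

Lemma innerDr u v w : inner u (v + w) = inner u v + inner u w.
Proof. by rewrite innerC innerDl !(innerC u). Qed.

Lemma innerZr a u v : inner u (a *: v) = a * inner u v.
Proof. by rewrite innerC innerZl innerC. Qed.

Lemma innerNr u v : inner u (- v) = - inner u v.
Proof. by rewrite innerC innerNl innerC. Qed.

Lemma inner0l v : inner 0 v = 0.
Proof. by rewrite -(scale0r v) innerZl mul0r. Qed.

Definition innerE :=
  (innerDl, innerDr, innerNl, innerNr, innerZl, innerZr).

Lemma inner_ge0 u : 0 <= inner u u.
Proof. by apply: sumr_ge0 => i _; rewrite -expr2 sqr_ge0. Qed.

Lemma inner_eq0 u : (inner u u == 0) = (u == 0).
Proof.
apply/idP/eqP => [|->]; last by rewrite inner0l.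
rewrite psumr_eq0; last by move=> i _; rewrite -expr2 sqr_ge0.
move=> /allP u0; apply/rowP => i; rewrite mxE; apply/eqP.
by have := u0 i (mem_index_enum i); rewrite /= mulf_eq0 orbb.
Qed.

Lemma enorm_sqr u : enorm u ^+ 2 = inner u u.
Proof. by rewrite sqr_sqrtr// inner_ge0. Qed.

Lemma enorm_ge0 u : 0 <= enorm u.
Proof. exact: sqrtr_ge0. Qed.

Lemma enorm_eq0 u : (enorm u == 0) = (u == 0).
Proof. by rewrite -inner_eq0 -enorm_sqr sqrf_eq0. Qed.

Lemma enorm_gt0 u : (0 < enorm u) = (u != 0).
Proof. by rewrite lt0r enorm_eq0 enorm_ge0 andbT. Qed.

Lemma enormZ a u : enorm (a *: u) = `|a| * enorm u.
Proof.
by rewrite /enorm innerZl innerZr mulrA -expr2 sqrtrM ?sqr_ge0// sqrtr_sqr.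
Qed.

Lemma enormN u : enorm (- u) = enorm u.
Proof. by rewrite /enorm innerNl innerNr opprK. Qed.

Lemma cauchy_schwarz_sqr u v : inner u v ^+ 2 <= inner u u * inner v v.
Proof.
have [->|v0] := eqVneq v 0; first by rewrite innerC !inner0l mulr0 expr0n.
have vv : 0 < inner v v by rewrite lt0r inner_eq0 v0 inner_ge0.
have := inner_ge0 (inner v v *: u - inner u v *: v).
rewrite !innerE (innerC v u) => h.
rewrite -subr_ge0 -(pmulr_rge0 _ vv); apply: le_trans h _.
by rewrite le_eqVlt; apply/orP; left; apply/eqP; ring.
Qed.

Lemma cauchy_schwarz u v : `|inner u v| <= enorm u * enorm v.
Proof.
rewrite -(ler_pXn2r (n := 2)) ?nnegrE ?mulr_ge0 ?enorm_ge0//.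
by rewrite exprMn !enorm_sqr real_normK ?num_real// cauchy_schwarz_sqr.
Qed.

Lemma enorm_triangle u v : enorm (u + v) <= enorm u + enorm v.
Proof.
rewrite -(ler_pXn2r (n := 2)) ?nnegrE ?addr_ge0 ?enorm_ge0//.
rewrite sqrrD !enorm_sqr !innerE (innerC v u).
have := ler_normlW (cauchy_schwarz u v); lra.
Qed.

End InnerProduct.

(** * Gradients and the strongly convex class *)

Section Calculus.
Context {R : realType} {n : nat}.
Implicit Types (x d : 'rV[R]_n) (f : 'rV[R]_n -> R).

(** Directional derivatives are one-variable derivatives along a line; this
    gives access to the one-dimensional criterion at a minimum. *)
Lemma derivable_line f x d t :
  derivable f (t *: d + x) d -> derivable (fun s : R => f (s *: d + x)) t 1.
Proof.
rewrite /derivable; set F := (X in cvg (X @ _) -> _) => H.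
rewrite (_ : (fun _ => _) = F)//; apply/funext => h; rewrite /F /=.
by rewrite [h%:A]mulr1 scalerDl addrA.
Qed.

Lemma derive_line f x d : 'D_1 (fun s : R => f (s *: d + x)) 0 = 'D_d f x.
Proof.
rewrite /derive; set F := (X in lim (X @ _) = _).
set G := (X in _ = lim (X @ _)); suff -> : F = G by [].
by apply/funext => h; rewrite /F /G /= [h%:A]mulr1 addr0 scale0r add0r.
Qed.

Lemma derive_quadratic f x d (a b : R) :
  (forall t, f (t *: d + x) = f x + t * a + t ^+ 2 * b) -> 'D_d f x = a.
Proof.
move=> fE; rewrite -derive_line.
rewrite (_ : (fun s => _) = (fun t : R => f x + t * a + t ^+ 2 * b)); last first.
  exact/funext.
suff dE : is_derive (0 : R) (1 : R) (fun t : R => f x + t * a + t ^+ 2 * b) a.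
  exact: derive_val.
apply: is_derive_eq.
rewrite !scaler0 /= /GRing.scale /=; ring.
Qed.

Lemma gradient_minimum f x :
  (forall y, differentiable f y) -> is_minimizer f x -> gradient f x = 0.
Proof.
move=> df fmin; apply/rowP => i; rewrite !mxE -derive_line.
have m11 : 0 \in `](-1), (1 : R)[ by rewrite in_itv/= ltrN10 ltr01.
suff dE : is_derive (0 : R) (1 : R) (fun s : R => f (s *: delta_mx 0 i + x)) 0.
  exact: derive_val.
apply: (derive1_at_min _ _ m11); first by lra.
- by move=> t _; apply/derivable_line/diff_derivable.
- by move=> t _; rewrite scale0r add0r.
Qed.

Lemma differentiable_inner w c x : differentiable (fun y : 'rV[R]_n => inner w (y - c)) x.
Proof.
rewrite (_ : (fun y => _) =
  \sum_(i < n) (fun y : 'rV[R]_n => w 0 i * (y 0 i - c 0 i))); last first.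
  by apply/funext => y; rewrite fct_sumE; apply: eq_bigr => i _; rewrite !mxE.
apply: differentiable_sum => i.
apply: differentiableM => //; apply: differentiableB => //.
exact: differentiable_coord.
Qed.

Lemma differentiable_inner2 c x :
  differentiable (fun y : 'rV[R]_n => inner (y - c) (y - c)) x.
Proof.
rewrite (_ : (fun y => _) = \sum_(i < n)
  (fun y : 'rV[R]_n => (y 0 i - c 0 i) * (y 0 i - c 0 i))); last first.
  by apply/funext => y; rewrite fct_sumE; apply: eq_bigr => i _; rewrite !mxE.
apply: differentiable_sum => i.
by apply: differentiableM; apply: differentiableB => //;
  apply: differentiable_coord.
Qed.

(** The one-parameter family of quadratics from which all witnesses are taken:
    an isotropic part with modulus [sigma] and a rank-one part along [w]. *)
Lemma quadratic_gradient (sigma k : R) c w x :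
  gradient (fun y : 'rV[R]_n => sigma / 2 * inner (y - c) (y - c)
                     + k / 2 * inner w (y - c) ^+ 2) x
  = sigma *: (x - c) + (k * inner w (x - c)) *: w.
Proof.
apply/rowP => i; rewrite !mxE.
set d := delta_mx 0 i.
have dE v : inner v d = v 0 i.
  rewrite /inner (bigD1 i)//= big1 ?addr0 => [|j ji]; last first.
    by rewrite mxE (negbTE ji) andbF mulr0.
  by rewrite mxE !eqxx mulr1.
rewrite (@derive_quadratic _ _ _
   (sigma * inner (x - c) d + k * inner w (x - c) * inner w d)
   (sigma / 2 * inner d d + k / 2 * inner w d ^+ 2)); last first.
  move=> t; rewrite -addrA !(innerDl (t *: d)) !(innerDr _ (t *: d)) !innerZr !innerZl.
  by rewrite (innerC d (x - c)); field.
by rewrite !dE !mxE.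
Qed.

Lemma quadratic_S_class (sigma k : R) c w : 0 <= sigma -> 0 <= k ->
  S_class c sigma (fun y : 'rV[R]_n => sigma / 2 * inner (y - c) (y - c)
                            + k / 2 * inner w (y - c) ^+ 2).
Proof.
move=> sigma0 k0; split.
- move=> x; have dI := @differentiable_inner w c x.
  have dQ := @differentiable_inner2 c x.
  apply: differentiableD; apply: differentiableM => //.
  by rewrite (_ : (fun y => _) =
    (fun y : 'rV[R]_n => inner w (y - c)) * (fun y => inner w (y - c)));
    [exact: differentiableM|apply/funext => y; rewrite expr2].
- move=> x y; rewrite !quadratic_gradient enorm_sqr.
  set d := x - y.
  have -> : sigma *: (x - c) + (k * inner w (x - c)) *: w -
    (sigma *: (y - c) + (k * inner w (y - c)) *: w) = sigma *: d + (k * inner w d) *: w.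
    have -> : x - c = d + (y - c) by rewrite /d addrA subrK.
    by rewrite innerDr; apply/rowP => i; rewrite !mxE; ring.
  move: d => d; rewrite innerDl !innerZl lerDl -mulrA mulr_ge0// -expr2 sqr_ge0//.
- move=> y; rewrite subrr (innerC w 0) !inner0l expr0n !mulr0 addr0.
  by rewrite addr_ge0// mulr_ge0 ?divr_ge0 ?inner_ge0 ?sqr_ge0.
Qed.

(** Put [w = g - sigma (x - c)]. The rank-one form [y |-> <w, y>^2 / <w, x - c>]
    has half-gradient [w] at [x - c] and is positive semidefinite since
    [<w, x - c> > 0]; if [w = 0] the isotropic part alone suffices. The
    boundary case [<w, x - c> = 0] with [w <> 0] is excluded: a
    positive semidefinite form that is null at a point has zero gradient there. *)
Lemma S_class_gradientP (sigma : R) c x g : 0 < sigma ->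
  g = sigma *: (x - c) \/ sigma * enorm (x - c) ^+ 2 < inner g (x - c) ->
  exists2 f, S_class c sigma f & gradient f x = g.
Proof.
move=> sigma0 gx; pose w := g - sigma *: (x - c).
exists (fun y : 'rV[R]_n => sigma / 2 * inner (y - c) (y - c)
                 + (inner w (x - c))^-1 / 2 * inner w (y - c) ^+ 2).
  apply: quadratic_S_class; first exact: ltW.
  rewrite invr_ge0.
  rewrite /w innerBl innerZl -enorm_sqr subr_ge0.
  by case: gx => [->|/ltW//]; rewrite innerZl -enorm_sqr.
rewrite quadratic_gradient; case: gx => [gE|gx].
  by rewrite [w](_ : _ = 0) ?scaler0 ?addr0// /w gE subrr.
rewrite mulVf ?scale1r; first by rewrite addrC subrK.
by rewrite gt_eqF// /w innerBl innerZl -enorm_sqr subr_gt0.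
Qed.

(** Strong convexity between [x] and the minimizer, where the gradient is 0. *)
Lemma S_class_gradient_ge (sigma : R) c f x : S_class c sigma f ->
  sigma * enorm (x - c) ^+ 2 <= inner (gradient f x) (x - c).
Proof.
move=> [df sc fmin].
by have := sc x c; rewrite (gradient_minimum df fmin) subr0.
Qed.

(** The ambient topology comes from the sup norm, so one inclusion is the
    continuity of [enorm], and the other approaches [x] along the segment
    from [c]. *)
Lemma closure_eball c (rho : R) : 0 < rho ->
  closure (eball c rho) = [set x : 'rV[R]_n | enorm (x - c) <= rho].
Proof.
move=> rho0; apply/seteqP; split=> x /=.
  suff cE : closed [set x : 'rV[R]_n | enorm (x - c) <= rho].
    move=> xB; apply: cE; apply: closure_subset xB => y /=; rewrite /eball/=; exact: ltW.
  apply: (@closed_comp _ _ (fun y : 'rV[R]_n => enorm (y - c))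
    [set t | t <= rho]); last exact: closed_le.
  move=> y _; apply: (@continuous_comp _ _ _
    (fun y : 'rV[R]_n => inner (y - c) (y - c)) Num.sqrt).
    exact/differentiable_continuous/differentiable_inner2.
  exact: sqrt_continuous.
move=> xrho B Bx.
have /(_ _ Bx) nB : (fun t : R => t *: (x - c) + c) @ (1 : R)^'- --> x.
  rewrite -{2}(subrK c x) -[in X in _ --> X](scale1r (x - c)).
  apply: cvgD; last exact: cvg_cst.
  by apply: cvgZr_tmp; apply: cvg_at_left_filter; exact: cvg_id.
near (1 : R)^'- => t.
exists (t *: (x - c) + c); split; last by near: t.
rewrite /eball/= addrK enormZ ger0_norm; last by near: t; exact: nbhs_left_ge.
have t1 : t < 1 by near: t; exact: nbhs_left_lt.
have t0 : 0 <= t by near: t; exact: nbhs_left_ge.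
apply: le_lt_trans (_ : t * rho < _); first exact: ler_wpM2l.
by rewrite gtr_pMl.
Unshelve. all: by end_near. Qed.

End Calculus.

(** * Angles between vectors *)

Section Angles.
Context {R : realType} {n : nat}.
Implicit Types (u v w e p q : 'rV[R]_n) (a b : R).

Lemma ler_cos : {in `[0, pi] &, {mono @cos R : x y /~ y <= x}}.
Proof. by move=> x y xI yI; rewrite !leNgt ltr_cos. Qed.

Lemma ler_acos a b : -1 <= a <= 1 -> -1 <= b <= 1 ->
  (acos a <= acos b) = (b <= a).
Proof.
move=> a1 b1; have [a0 aE] := acos_def a1; have [b0 bE] := acos_def b1.
by rewrite -{2}aE -{2}bE ler_cos.
Qed.

Lemma cosine_bounds u v : -1 <= inner u v / (enorm u * enorm v) <= 1.
Proof.
rewrite -ler_norml normrM normfV (ger0_norm (mulr_ge0 (enorm_ge0 u) (enorm_ge0 v))).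
have := cauchy_schwarz u v; set m := enorm u * enorm v => uv.
have [m0|m0] := eqVneq m 0; first by rewrite m0 invr0 mulr0 ler01.
by rewrite ler_pdivrMr ?mul1r// lt0r m0 mulr_ge0// enorm_ge0.
Qed.

Lemma angle_ge0 u v : 0 <= angle u v.
Proof. exact/acos_ge0/cosine_bounds. Qed.

Lemma angle_le_pi u v : angle u v <= pi.
Proof. exact/acos_lepi/cosine_bounds. Qed.

Lemma angle_itv u v : angle u v \in `[0, pi].
Proof. by rewrite in_itv/= angle_ge0 angle_le_pi. Qed.

Lemma cos_angle u v : cos (angle u v) = inner u v / (enorm u * enorm v).
Proof. by apply: acosK; rewrite in_itv/= cosine_bounds. Qed.

Lemma angleC u v : angle u v = angle v u.
Proof. by rewrite /angle innerC [enorm u * _]mulrC. Qed.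

Lemma angleNl u v : angle (- u) v = pi - angle u v.
Proof. by rewrite /angle innerNl enormN mulNr acosN// cosine_bounds. Qed.

Lemma angle_le_acos u v a : u != 0 -> v != 0 -> -1 <= a <= 1 ->
  (angle u v <= acos a) = (a * (enorm u * enorm v) <= inner u v).
Proof.
move=> u0 v0 a1.
by rewrite ler_acos ?cosine_bounds// ler_pdivlMr// mulr_gt0// enorm_gt0.
Qed.

Lemma sin_angle u v : u != 0 -> v != 0 -> sin (angle u v) =
  Num.sqrt (inner u u * inner v v - inner u v ^+ 2) / (enorm u * enorm v).
Proof.
move=> u0 v0; have U0 := u0; have V0 := v0.
rewrite -enorm_eq0 in U0; rewrite -enorm_eq0 in V0.
rewrite sin_acos ?cosine_bounds//.
rewrite -[RHS]ger0_norm ?divr_ge0 ?sqrtr_ge0 ?mulr_ge0 ?enorm_ge0//.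
rewrite -sqrtr_sqr; congr Num.sqrt.
rewrite [in RHS]exprMn sqr_sqrtr ?subr_ge0 ?cauchy_schwarz_sqr// -!enorm_sqr.
move: (enorm u) (enorm v) (inner u v) U0 V0 => U V k U0 V0.
by field; rewrite U0 V0.
Qed.

(** Cauchy-Schwarz for the components of [u] and [w] orthogonal to [v]; for
    unit vectors the right-hand side is the product of the sines of the angles
    with [v]. *)
Lemma cauchy_schwarz_orthogonal u v w : inner v v = 1 ->
  `|inner u w - inner u v * inner v w| <=
  Num.sqrt (inner u u - inner u v ^+ 2) * Num.sqrt (inner w w - inner v w ^+ 2).
Proof.
move=> v1; have := cauchy_schwarz (u - inner u v *: v) (w - inner v w *: v).
rewrite /enorm; have -> : inner (u - inner u v *: v) (w - inner v w *: v)
  = inner u w - inner u v * inner v w by rewrite !innerE v1; ring.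
have -> : inner (u - inner u v *: v) (u - inner u v *: v)
  = inner u u - inner u v ^+ 2 by rewrite !innerE (innerC v u) v1; ring.
have -> : inner (w - inner v w *: v) (w - inner v w *: v)
  = inner w w - inner v w ^+ 2 by rewrite !innerE (innerC w v) v1; ring.
by [].
Qed.

Lemma angleZ a b u v : 0 < a -> 0 < b -> angle (a *: u) (b *: v) = angle u v.
Proof.
move=> a0 b0; rewrite /angle innerZl innerZr !enormZ !gtr0_norm//.
by rewrite mulrACA mulrA invfM mulrACA divff ?mul1r// mulf_neq0 ?gt_eqF.
Qed.

Definition normalize u := (enorm u)^-1 *: u.

Lemma enorm_normalize u : u != 0 -> enorm (normalize u) = 1.
Proof.
move=> u0; rewrite enormZ ger0_norm ?invr_ge0 ?enorm_ge0// mulVf//.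
by rewrite enorm_eq0.
Qed.

(** After normalization, [cauchy_schwarz_orthogonal] says that
    [cos (angle u w) >= cos (angle u v + angle v w)]. *)
Lemma angle_triangle u v w : u != 0 -> v != 0 -> w != 0 ->
  angle u w <= angle u v + angle v w.
Proof.
wlog u1 : u v w / [/\ enorm u = 1, enorm v = 1 & enorm w = 1].
  move=> wl u0 v0 w0; have /= := wl (normalize u) (normalize v) (normalize w).
  rewrite !enorm_normalize// !angleZ ?invr_gt0 ?enorm_gt0//.
  by apply => //; rewrite -enorm_eq0 enorm_normalize// oner_eq0.
move: u1 => [u1 v1 w1] u0 v0 w0.
have [lepi|gtpi] := leP (angle u v + angle v w) pi; last first.
  exact: le_trans (angle_le_pi u w) (ltW gtpi).
have sumI : angle u v + angle v w \in `[0, pi].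
  by rewrite in_itv/= lepi addr_ge0// angle_ge0.
have := @cauchy_schwarz_orthogonal u v w.
rewrite -!enorm_sqr u1 v1 w1 !expr1n => /(_ erefl).
rewrite -ler_cos ?angle_itv// cosD !sin_angle// -!enorm_sqr !cos_angle.
rewrite u1 v1 w1 !expr1n !mulr1 !divr1.
by move=> /ler_normlP[]; lra.
Qed.

(** In the triangle with sides [v], [e] and [v + e] the exterior angle between
    [v] and [e] is the sum of the two opposite interior angles. Both sides lie
    in [[0, pi]] and have the same cosine: the two sines on the left share the
    same Gram determinant [D], the square of twice the area of the triangle. *)
Lemma exterior_angle v e : v != 0 -> e != 0 -> v + e != 0 ->
  angle v e - angle (v + e) e = angle (v + e) v.
Proof.
move=> v0 e0 u0.
have V0 : 0 < enorm v by rewrite enorm_gt0.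
have E0 : 0 < enorm e by rewrite enorm_gt0.
have U0 : 0 < enorm (v + e) by rewrite enorm_gt0.
have U2 : inner (v + e) (v + e) = enorm v ^+ 2 + 2 * inner v e + enorm e ^+ 2.
  by rewrite !innerE -!enorm_sqr (innerC e v); ring.
have ue : inner (v + e) e = inner v e + enorm e ^+ 2 by rewrite innerDl enorm_sqr.
have uv : inner (v + e) v = enorm v ^+ 2 + inner v e.
  by rewrite innerDl enorm_sqr innerC (innerC v e).
have ve : `|inner v e| <= enorm v * enorm e by exact: cauchy_schwarz.
have le_angle : angle (v + e) e <= angle v e.
  rewrite ler_acos ?cosine_bounds//.
  rewrite ler_pdivrMr ?mulr_gt0// mulrAC ler_pdivlMr ?mulr_gt0// ue !mulrA ler_pM2r//.
  (* [|v + e|] differs from [|v|] by at most [|e|], and [|<v, e>| <= |v| |e|] *)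
  have h1 := enorm_triangle v e.
  have h2 : enorm v <= enorm (v + e) + enorm e.
    by rewrite -{1}(addrK e v) (le_trans (enorm_triangle _ _))// enormN.
  move: ve => /ler_normlP[h3 h4].
  have [a0|a0] := leP 0 (inner v e); nra.
apply: cos_inj; rewrite ?angle_itv//.
  by rewrite in_itv/= subr_ge0 le_angle lerBlDr/= (le_trans (angle_le_pi _ _))//
    lerDl angle_ge0.
rewrite cosB !sin_angle// !cos_angle ue uv U2.
set D := (X in Num.sqrt X / _ * _); set D' := (X in _ * (Num.sqrt X / _)).
have DE : D' = D by rewrite /D /D' -!enorm_sqr; ring.
have : Num.sqrt D ^+ 2 = D by rewrite sqr_sqrtr// subr_ge0 cauchy_schwarz_sqr.
rewrite DE; rewrite /D -!enorm_sqr.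
move: (Num.sqrt _) => S SE.
move: (enorm v) (enorm e) (enorm (v + e)) (inner v e) V0 E0 U0 SE => V E U a V0 E0 U0 SE.
have -> : a / (V * E) * ((a + E ^+ 2) / (U * E)) + S / (V * E) * (S / (U * E))
   = (a * (a + E ^+ 2) + S ^+ 2) / (V * E * (U * E)).
  by field; rewrite !gt_eqF.
by rewrite SE; field; rewrite !gt_eqF.
Qed.

(** Equality in the triangle inequality for [u - v]: expanding the square
    gives [<u, v> = - |u| |v|], hence [|a u + b v|^2 = (a |u| - b |v|)^2 = 0]. *)
Lemma opposite_of_enormB u v a b : a * enorm u = b * enorm v ->
  enorm (u - v) = enorm u + enorm v -> - (a *: u) = b *: v.
Proof.
move=> ab uv; apply/eqP; rewrite eq_sym -subr_eq0 opprK -enorm_eq0 -sqrf_eq0.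
have := enorm_sqr (u - v).
rewrite uv enorm_sqr !innerE -!enorm_sqr !(innerC v u) => ee.
have -> : inner u v = - (enorm u * enorm v) by lra.
have -> : b * (b * enorm v ^+ 2 + a * - (enorm u * enorm v)) +
   a * (b * - (enorm u * enorm v) + a * enorm u ^+ 2)
   = (a * enorm u - b * enorm v) ^+ 2 by ring.
by rewrite ab subrr expr0n.
Qed.

(** With [c1] and [c2] the cosines of the half-angles, the hypothesis on
    [inner p q] says that the angle between the axes is less than the sum of the
    half-angles. If one axis lies in the other cone, it is the direction sought.
    Otherwise the vector [h] of the plane of [p] and [q] with [<h, p> = c1] and
    [<h, q> = c2] has norm less than 1, because its Gram condition
    [(k - c1 c2)^2 < (1 - c1^2) (1 - c2^2)] holds; normalizing it increases both
    products. The alternative [g = p /\ c1 = 1] is a cone reduced to its axis. *)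
Lemma direction_in_cones p q (c1 c2 : R) :
  enorm p = 1 -> enorm q = 1 -> 0 < c1 <= 1 -> 0 < c2 <= 1 ->
  c1 * c2 - Num.sqrt (1 - c1 ^+ 2) * Num.sqrt (1 - c2 ^+ 2) < inner p q ->
  exists g, [/\ enorm g = 1, c1 < inner g p \/ (g = p /\ c1 = 1)
                & c2 < inner g q \/ (g = q /\ c2 = 1)].
Proof.
move=> p1 q1 /andP[c1_gt0 c1_le1] /andP[c2_gt0 c2_le1] kgt.
have pp : inner p p = 1 by rewrite -enorm_sqr p1 expr1n.
have qq : inner q q = 1 by rewrite -enorm_sqr q1 expr1n.
have self (c : R) (w : 'rV[R]_n) :
    enorm w = 1 -> c <= 1 -> c < inner w w \/ (w = w /\ c = 1).
  rewrite -enorm_sqr => ->; rewrite expr1n le_eqVlt => /orP[/eqP ->|]; [by right|by left].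
have [pq_gt|pq_le1] := ltP c1 (inner p q).
  by exists q; split; [|left; rewrite innerC|exact: self].
have [pq_gt|pq_le2] := ltP c2 (inner p q).
  by exists p; split; [|exact: self|left].
have s1_ge0 := sqrtr_ge0 (1 - c1 ^+ 2); have s2_ge0 := sqrtr_ge0 (1 - c2 ^+ 2).
have s1E : Num.sqrt (1 - c1 ^+ 2) ^+ 2 = 1 - c1 ^+ 2 by rewrite sqr_sqrtr//; nra.
have s2E : Num.sqrt (1 - c2 ^+ 2) ^+ 2 = 1 - c2 ^+ 2 by rewrite sqr_sqrtr//; nra.
move: (Num.sqrt (1 - c1 ^+ 2)) (Num.sqrt (1 - c2 ^+ 2)) kgt s1_ge0 s2_ge0
  s1E s2E => s1 s2 kgt s1_ge0 s2_ge0 s1E s2E.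
(* [s1] and [s2] are the sines of the half-angles. *)
set k := inner p q in kgt pq_le1 pq_le2.
have s1_gt0 : 0 < s1.
  rewrite lt0r s1_ge0 andbT; apply/eqP => s10.
  have : c1 = 1 by apply/eqP; rewrite eq_le c1_le1 /=; nra.
  by move: kgt; rewrite s10 mul0r; nra.
have s2_gt0 : 0 < s2.
  rewrite lt0r s2_ge0 andbT; apply/eqP => s20.
  have : c2 = 1 by apply/eqP; rewrite eq_le c2_le1 /=; nra.
  by move: kgt; rewrite s20 mulr0; nra.
have klt : k < c1 * c2 + s1 * s2.
  have [c12|c21] := leP c1 c2.
    have s21 : s2 <= s1 by rewrite -(ler_pXn2r (n := 2)) ?nnegrE// s1E s2E; nra.
    nra.
  have s12 : s1 <= s2 by rewrite -(ler_pXn2r (n := 2)) ?nnegrE ?s1E ?s2E//; nra.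
  nra.
(* [c1 c2 + s1 s2] and [c1 c2 - s1 s2] are cosines, of the difference and of
   the sum of the half-angles. *)
have k_lt1 : k < 1 by have := sqr_ge0 (c1 - c2); have := sqr_ge0 (s1 - s2); nra.
have k_gtN1 : - 1 < k by have := sqr_ge0 (c1 + c2); have := sqr_ge0 (s1 - s2); nra.
have k2 : 0 < 1 - k ^+ 2 by nra.
have gramE : (k - c1 * c2) ^+ 2 < (1 - c1 ^+ 2) * (1 - c2 ^+ 2).
  by rewrite -s1E -s2E; nra.
(* Cramer's rule for the 2 x 2 Gram system. *)
pose h := ((c1 - k * c2) / (1 - k ^+ 2)) *: p + ((c2 - k * c1) / (1 - k ^+ 2)) *: q.
have k2_neq0 : 1 - k ^+ 2 != 0 by rewrite gt_eqF.
have hp : inner h p = c1.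
  by rewrite /h !innerE pp (innerC q p) -/k; field.
have hq : inner h q = c2 by rewrite /h !innerE qq -/k; field.
have hh : inner h h = (c1 ^+ 2 + c2 ^+ 2 - 2 * k * c1 * c2) / (1 - k ^+ 2).
  by rewrite {2}/h innerDr !innerZr hp hq; field.
have hn : enorm h != 0.
  rewrite enorm_eq0; apply/eqP => h0.
  by move: c1_gt0; rewrite -hp h0 inner0l ltxx.
have h_gt0 : 0 < enorm h by rewrite lt0r hn enorm_ge0.
have h_lt1 : enorm h < 1.
  rewrite -(ltr_pXn2r (n := 2)) ?nnegrE ?enorm_ge0// enorm_sqr hh expr1n.
  by rewrite ltr_pdivrMr//; nra.
exists (normalize h); split; first by rewrite enorm_normalize// -enorm_eq0.
  by left; rewrite innerZl hp ltr_pMl// invf_gt1.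
by left; rewrite innerZl hq ltr_pMl// invf_gt1.
Qed.

End Angles.

(** * The inclusions *)

Section Inclusions.
Context {R : realType} {n : nat}.
Context (r sigma1 sigma2 L : R) (n_gt0 : (0 < n)%N) (r_gt0 : 0 < r).
Context (sigma1_gt0 : 0 < sigma1) (sigma2_gt0 : 0 < sigma2) (L_gt0 : 0 < L).

Local Notation x1 := (xstar1 n r).
Local Notation x2 := (xstar2 n r).
Implicit Type x : 'rV[R]_n.

Lemma minimizers_neq : x2 - x1 != 0.
Proof.
apply/eqP => /rowP /(_ (Ordinal n_gt0)); rewrite !mxE /=. by move: r_gt0; lra.
Qed.

Lemma domainE x : domain r sigma1 sigma2 L x <->
  [/\ enorm (x - x1) <= L / sigma1, enorm (x - x2) <= L / sigma2,
      x - x1 != 0 & x - x2 != 0].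
Proof.
rewrite /domain /B1 /B2 !closure_eball ?divr_gt0//= !subr_eq0; split.
  by move=> [[? ?] /not_orP[/eqP ? /eqP ?]].
by move=> [? ? /eqP ? /eqP ?]; split=> // -[].
Qed.

Lemma psiE x : x - x1 != 0 -> x - x2 != 0 ->
  psi r x = pi - angle (x - x1) (x - x2).
Proof.
move=> u0 v0; have uE : x - x1 = (x - x2) + (x2 - x1) by rewrite addrA subrK.
rewrite /psi /alpha1 /alpha2 uE exterior_angle -?uE//.
exact: minimizers_neq.
Qed.

Lemma ratio_bounds (sigma t : R) : 0 < sigma -> 0 <= t -> t <= L / sigma ->
  0 <= sigma / L * t <= 1.
Proof.
move=> sigma0 t0; rewrite ler_pdivlMr// => tL; apply/andP; split.
  by rewrite mulr_ge0// divr_ge0// ltW.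
by rewrite mulrAC ler_pdivrMr// mul1r mulrC.
Qed.

(** At [c1] the gradient of [f1], hence that of [f2], would vanish; strong
    convexity of [f2] then puts [x] at [c2] as well. *)
Lemma common_point_neq (s1 s2 : R) (c1 c2 x : 'rV[R]_n) f1 f2 : 0 < s2 ->
  c1 != c2 -> S_class c1 s1 f1 -> S_class c2 s2 f2 ->
  gradient f1 x = - gradient f2 x -> x - c1 != 0.
Proof.
move=> s2_gt0 c12 [df1 _ min1] S2 gE; apply: contra c12; rewrite subr_eq0 => /eqP xc1.
have g20 : gradient f2 x = 0.
  by apply: oppr_inj; rewrite -gE oppr0 xc1; exact: gradient_minimum.
have := S_class_gradient_ge x S2.
rewrite g20 inner0l pmulr_rle0// => v0.
have : enorm (x - c2) ^+ 2 == 0 by rewrite eq_le v0 sqr_ge0.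
by rewrite sqrf_eq0 enorm_eq0 subr_eq0 xc1.
Qed.

(** [cos (angle g u)] is at least [sigma |u| / |g|], hence at least
    [sigma |u| / L]. *)
Lemma gradient_cone (sigma : R) (g u : 'rV[R]_n) : 0 < sigma -> u != 0 ->
  enorm g <= L -> sigma * enorm u ^+ 2 <= inner g u ->
  [/\ g != 0, enorm u <= L / sigma
    & angle g u <= acos (sigma / L * enorm u)].
Proof.
move=> sigma0 u0 gL gu.
have U0 : 0 < enorm u by rewrite enorm_gt0.
have gu' : inner g u <= enorm g * enorm u := ler_normlW (cauchy_schwarz g u).
have sug : sigma * enorm u <= enorm g.
  by rewrite -(ler_pM2r U0) -mulrA -expr2 (le_trans gu).
have g0 : g != 0.
  by rewrite -enorm_gt0; apply: lt_le_trans sug; rewrite mulr_gt0.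
have uL : enorm u <= L / sigma by rewrite ler_pdivlMr// mulrC (le_trans sug).
split=> //.
have /andP[a0 a1] := ratio_bounds sigma0 (ltW U0) uL.
rewrite angle_le_acos ?a1 ?andbT//; last by rewrite (le_trans _ a0)// lerN10.
apply: le_trans gu.
have -> : sigma / L * enorm u * (enorm g * enorm u)
  = enorm g / L * (sigma * enorm u ^+ 2) by field; rewrite gt_eqF.
apply: ler_piMl; first by rewrite mulr_ge0 ?sqr_ge0// ltW.
by rewrite ler_pdivrMr// mul1r.
Qed.

Lemma solution_sub_outer :
  solution_region n r sigma1 sigma2 L `<=` outer_region n r sigma1 sigma2 L.
Proof.
move=> x [f1 [f2 [S1 S2 gE _ gL]]].
have g1 := S_class_gradient_ge x S1.
have g2 := S_class_gradient_ge x S2.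
have gL1 : enorm (gradient f1 x) <= L by rewrite gE enormN.
have x12 : x1 != x2 by rewrite eq_sym -subr_eq0 minimizers_neq.
have u0 : x - x1 != 0 := common_point_neq sigma2_gt0 x12 S1 S2 gE.
have v0 : x - x2 != 0.
  rewrite eq_sym in x12.
  by apply: (common_point_neq sigma1_gt0 x12 S2 S1); rewrite gE opprK.
have [h0 uL phi1_ge] := gradient_cone sigma1_gt0 u0 gL1 g1.
have [_ vL phi2_ge] := gradient_cone sigma2_gt0 v0 gL g2.
split; first exact/domainE.
rewrite psiE// /phi1 /phi2.
(* Trade the angle of [-g] with [v] for that of [g] with [v]. *)
rewrite -[gradient f2 x]opprK -gE angleNl in phi2_ge.
have := angle_triangle h0 u0 v0.
by move: phi1_ge phi2_ge; lra.
Qed.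

Lemma inner_sub_solution :
  inner_region n r sigma1 sigma2 L `<=` solution_region n r sigma1 sigma2 L.
Proof.
have from_gradient x g : enorm g <= L ->
    g = sigma1 *: (x - x1) \/ sigma1 * enorm (x - x1) ^+ 2 < inner g (x - x1) ->
    - g = sigma2 *: (x - x2) \/ sigma2 * enorm (x - x2) ^+ 2 < inner (- g) (x - x2) ->
    solution_region n r sigma1 sigma2 L x.
  move=> gL /(S_class_gradientP sigma1_gt0)[f1 S1 g1].
  move=> /(S_class_gradientP sigma2_gt0)[f2 S2 g2].
  by exists f1, f2; rewrite g1 g2 opprK enormN.
move=> x [[/domainE[uL vL u0 v0] phi_gt]|[e_eq [uE vE]]]; last first.
  have uv : x2 - x1 = (x - x1) - (x - x2) by rewrite opprB [RHS]addrC subrKA.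
  apply: (from_gradient x (sigma1 *: (x - x1))).
  - by rewrite enormZ gtr0_norm// uE mulrC divfK ?gt_eqF.
  - by left.
  - left; apply: opposite_of_enormB; rewrite -?uv ?e_eq uE vE; field.
    + by rewrite !gt_eqF.
    + by rewrite !gt_eqF.
have U0 : 0 < enorm (x - x1) by rewrite enorm_gt0.
have V0 : 0 < enorm (x - x2) by rewrite enorm_gt0.
move: phi_gt; rewrite psiE// /phi1 /phi2.
set c1 := sigma1 / L * _; set c2 := sigma2 / L * _.
have c1_gt0 : 0 < c1 by rewrite mulr_gt0// divr_gt0.
have c2_gt0 : 0 < c2 by rewrite mulr_gt0// divr_gt0.
have /andP[_ c1_le1] := ratio_bounds sigma1_gt0 (ltW U0) uL.
have /andP[_ c2_le1] := ratio_bounds sigma2_gt0 (ltW V0) vL.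
rewrite -/c1 in c1_le1; rewrite -/c2 in c2_le1.
(* [pi - angle u v] is the angle between [u] and [-v]. *)
rewrite angleC -angleNl angleC => phi_gt.
have acos_le (c : R) : 0 < c -> c <= 1 -> 0 <= acos c <= pi / 2.
  move=> c0 c_le1; have cB : -1 <= c <= 1 by rewrite c_le1 andbT; lra.
  by rewrite acos_ge0// -acos0 ler_acos ?(ltW c0)// lerN10 ler01.
have /andP[p1_ge p1_le] := acos_le _ c1_gt0 c1_le1.
have /andP[p2_ge p2_le] := acos_le _ c2_gt0 c2_le1.
(* [phi1 + phi2 <= pi], so that cosines can be compared. *)
have cos_lt : cos (acos c1 + acos c2) < cos (angle (x - x1) (- (x - x2))).
  rewrite ltr_cos ?angle_itv// in_itv/= addr_ge0//=; lra.
have c1B : -1 <= c1 <= 1 by rewrite c1_le1 andbT; lra.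
have c2B : -1 <= c2 <= 1 by rewrite c2_le1 andbT; lra.
rewrite cos_angle cosD !sin_acos// !acosK ?in_itv//= in cos_lt.
have v0' : - (x - x2) != 0 by rewrite oppr_eq0.
have inner_unit : inner (normalize (x - x1)) (normalize (- (x - x2))) =
    inner (x - x1) (- (x - x2)) / (enorm (x - x1) * enorm (- (x - x2))).
  by rewrite innerZl innerZr mulrA -invfM mulrC.
rewrite -inner_unit in cos_lt.
have c1I : 0 < c1 <= 1 by rewrite c1_gt0.
have c2I : 0 < c2 <= 1 by rewrite c2_gt0.
have [g [g1 gp gq]] := direction_in_cones (enorm_normalize u0)
  (enorm_normalize v0') c1I c2I cos_lt.
(* A unit vector in a cone, scaled by [L], satisfies the criterion of
   [S_class_gradientP]; a degenerate cone means [sigma |w| = L]. *)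
have scaled (sigma : R) (w h : 'rV[R]_n) : 0 < sigma -> w != 0 ->
    sigma / L * enorm w < inner h (normalize w) \/
      (h = normalize w /\ sigma / L * enorm w = 1) ->
    L *: h = sigma *: w \/ sigma * enorm w ^+ 2 < inner (L *: h) w.
  rewrite -enorm_gt0 => sigma0 W0 [hw|[-> sw]].
    right; move: hw; rewrite innerZl innerZr => hw.
    have -> : sigma * enorm w ^+ 2 = (L * enorm w) * (sigma / L * enorm w).
      by field; rewrite gt_eqF.
    have -> : L * inner h w = (L * enorm w) * ((enorm w)^-1 * inner h w).
      by field; rewrite gt_eqF.
    by rewrite ltr_pM2l// mulr_gt0.
  left; rewrite scalerA; congr (_ *: _).
  by rewrite -[LHS]mulr1 -sw; field; rewrite !gt_eqF.
apply: (from_gradient x (L *: g)).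
- by rewrite enormZ g1 mulr1 gtr0_norm.
- exact: scaled.
- have := scaled _ _ _ sigma2_gt0 v0'; rewrite enormN => /(_ _ gq).
  rewrite innerNr innerNl scalerN => -[gE|]; last by right.
  by left; rewrite gE opprK.
Qed.

End Inclusions.

Theorem proposition6p1 (R : realType) (n : nat) (r sigma1 sigma2 L : R)
    (n_gt0 : (0 < n)%N) (r_gt0 : 0 < r)
    (sigma1_gt0 : 0 < sigma1) (sigma2_gt0 : 0 < sigma2) (L_gt0 : 0 < L) :
  inner_region n r sigma1 sigma2 L `<=` solution_region n r sigma1 sigma2 L /\
  solution_region n r sigma1 sigma2 L `<=` outer_region n r sigma1 sigma2 L.
Proof.
by split; [exact: inner_sub_solution|exact: solution_sub_outer].
Qed.
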